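(* Let $K,C\subset\mathbb{R}^2$ be convex bodies such that $0\in C$ and $\dim(C)=2$. Then $$D_{\mathrm{MAX}}(K,C)\ge\frac23R(K,C).$$ Moreover, for a convex body $C\subset\mathbb{R}^2$ with $0\in C$ and $\dim(C)=2$, equality is attained for some convex body $K\subset\mathbb{R}^2$ that is not a single point if and only if $C$ is a triangle with one vertex at the origin.
   Context: A convex body is a nonempty compact convex set. $h_C(a)=\max_{x\in C}a^Tx$ is the support function. The circumradius is $R(K,C)=\inf\{\rho\ge0:\exists t,\ K\subset t+\rho C\}$. The maximum diameter is $$D_{\mathrm{MAX}}(K,C)=\max_{u\in\mathbb{R}^2\setminus\{0\}}\frac{h_K(u)+h_K(-u)}{\max(h_C(u),h_C(-u))}.$$ Here $C$ is not required to be Minkowski-centered, nor to contain $0$ in its interior. *)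

(* Defs.v *)
From HB Require Import structures.
From mathcomp Require Import all_boot all_order all_algebra.
From mathcomp Require Import all_classical all_reals all_analysis.
Import Order.TTheory GRing.Theory Num.Theory.
Import numFieldNormedType.Exports.

Set Implicit Arguments.
Unset Strict Implicit.
Unset Printing Implicit Defensive.

Local Open Scope classical_set_scope.
Local Open Scope ring_scope.

Section Defs.
Context {R : realType} {n : nat}.
Implicit Types (A C K : set 'rV[R]_n) (a p q r t u x : 'rV[R]_n).

(* The sup norm topology on 'rV[R]_n is the Euclidean topology. *)
Definition convex_body C := [/\ C !=set0, compact C & convex_set C].

Definition dot a x : R := (a *m x^T) 0 0.

(* The maximum is attained when C is a convex body. *)
Definition support C a : R := sup [set dot a x | x in C].

Definition circumradius K C : R :=
  inf [set rho : R | 0 <= rho /\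
        exists t, K `<=` [set t + rho *: x | x in C]].

(* When 0 \in C and C has full dimension, the denominator is positive for
   u != 0 and the maximum is attained. *)
Definition DMAX K C : R :=
  sup [set (support K u + support K (- u)) /
           Num.max (support C u) (support C (- u)) | u in [set u | u != 0]].

Definition flat p (U : {vspace 'rV[R]_n}) : set 'rV[R]_n :=
  [set p + v | v in [set` U]].

Definition affine_hull A : set 'rV[R]_n :=
  smallest [set F | exists p U, F = flat p U] A.

(* The dimension as a relation; it is functional since a flat determines its
   direction U. *)
Definition has_dim A (d : nat) : Prop :=
  exists p U, affine_hull A = flat p U /\ \dim U = d.

Definition convex_hull A : set 'rV[R]_n :=
  smallest [set D : set 'rV[R]_n | convex_set D] A.

Definition triangle p q r C : Prop :=
  free [:: q - p; r - p] /\ C = convex_hull [set p; q; r].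

End Defs.

(* Main.v *)
Require Import Defs.
From mathcomp Require Import all_boot all_order all_algebra.
From mathcomp Require Import all_classical all_reals all_analysis.
From mathcomp Require Import ring lra.
Import Order.TTheory GRing.Theory Num.Theory.
Import numFieldNormedType.Exports Defs.
Local Open Scope classical_set_scope.
Local Open Scope ring_scope.

(** Write [h] for the support function of [C], [D] for [DMAX K C] and [r] for
    [circumradius K C]. Since [0] lies in [C], [h >= 0], and [D] is the least
    constant with [u . (x - y) <= D * max (h u) (h (- u))] for all [x], [y] in
    [K] and all [u] (lemmas [DMAX_diam] and [DMAX_le]).

    Duality. If no translate of [rho C] contains [K], then by Helly's theorem
    in the plane, applied to the compact convex sets [x - rho C], no translate
    contains some three points [p1], [p2], [p3] of [K]; minimising the mutual
    distances of the points [pi - rho ci], with [ci] in [C], then produces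
    normals [a1 + a2 + a3 = 0] with
    [rho * (h a1 + h a2 + h a3) < a1 . p1 + a2 . p2 + a3 . p3]
    ([uncontained_triple]).

    Inequality. Let [h a1] be the largest of the three values. The identity
    [2 (a1 . p1 + a2 . p2 + a3 . p3)
       = a1 . (p1 - p2) + a1 . (p1 - p3) + (a2 - a3) . (p2 - p3)]
    bounds the left side by [D] times
    [2 max (h a1) (h a2 + h a3) + h a1 + 2 max (h a2) (h a3)], because
    [- a1 = a2 + a3], [a2 - a3 = a1 + 2 a2] and [a3 - a2 = a1 + 2 a3]. This is
    at most [3 D (h a1 + h a2 + h a3)] ([triple_le]), so the strict inequality
    above is impossible for [rho = 3/2 D].

    Equality. If [r = 3/2 D > 0], compactness carries the duality from
    [rho < r] to [rho = r] ([extremal_triple]), and then every estimate is an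
    equality: [h a2 = h a3 = 0], so [C] lies in the triangle [T] cut out by
    [a2 <= 0], [a3 <= 0], [a1 <= h a1], which has a vertex at [0], while
    [p2 - p3] points to the midpoint of an edge of the parallelogram
    [conv (T, - T)]. If one of the other two vertices of [T] were missing from
    [C], tilting the functional [a2 - a3] about that midpoint would give a
    direction in which [p2 - p3] is longer than [D] allows ([extremal_vertex]).
    Hence [C = T].

    Conversely, for [C = conv (0, p, q)] the triangle
    [K = conv (3/4 (p + q), q/2, p/2)] has [D <= 1] and [r >= 3/2]
    ([triangle_equality]). *)

(** * The dot product and continuity *)

Lemma continuousT_comp {T U V : topologicalType} {f : T -> U} {g : U -> V} :
  continuous f -> continuous g -> continuous (fun x => g (f x)).
Proof. by move=> cf cg x; exact: (continuous_comp (cf x) (cg (f x))). Qed.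

Lemma continuous_fst {T U : topologicalType} : continuous (@fst T U).
Proof. by move=> x; exact: cvg_fst. Qed.

Lemma continuous_snd {T U : topologicalType} : continuous (@snd T U).
Proof. by move=> x; exact: cvg_snd. Qed.

Section Dot.
Context {R : realType} {n : nat}.
Implicit Types (a b x y : 'rV[R]_n) (k : R).

Lemma dotE a x : dot a x = \sum_i a 0 i * x 0 i.
Proof. by rewrite /dot mxE; apply: eq_bigr => i _; rewrite mxE. Qed.

Lemma dotC a x : dot a x = dot x a.
Proof. by rewrite !dotE; apply: eq_bigr => i _; rewrite mulrC. Qed.

Lemma dotDr a x y : dot a (x + y) = dot a x + dot a y.
Proof. by rewrite /dot linearD mulmxDr mxE. Qed.

Lemma dotZr a k x : dot a (k *: x) = k * dot a x.
Proof. by rewrite /dot linearZ -scalemxAr mxE. Qed.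

Lemma dotNr a x : dot a (- x) = - dot a x.
Proof. by rewrite -scaleN1r dotZr mulN1r. Qed.

Lemma dotDl a b x : dot (a + b) x = dot a x + dot b x.
Proof. by rewrite /dot mulmxDl mxE. Qed.

Lemma dotZl a k x : dot (k *: a) x = k * dot a x.
Proof. by rewrite dotC dotZr dotC. Qed.

Lemma dotNl a x : dot (- a) x = - dot a x.
Proof. by rewrite dotC dotNr dotC. Qed.

Lemma dot0r a : dot a 0 = 0.
Proof. by rewrite /dot trmx0 mulmx0 mxE. Qed.

Lemma dot0l a : dot 0 a = 0.
Proof. by rewrite dotC dot0r. Qed.

Definition dot_bilinear := (dotDl, dotDr, dotZl, dotZr, dotNl, dotNr).

Lemma dot_ge0 a : 0 <= dot a a.
Proof. by rewrite dotE sumr_ge0 // => i _; rewrite -expr2 sqr_ge0. Qed.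

Lemma dot_eq0 a : dot a a = 0 -> a = 0.
Proof.
rewrite dotE => /eqP; rewrite psumr_eq0 => [/allP a0|i _]; last first.
  by rewrite -expr2 sqr_ge0.
apply/rowP => i; rewrite mxE; apply/eqP.
by have := a0 i (mem_index_enum i); rewrite -expr2 sqrf_eq0.
Qed.

Lemma continuous_dot (T : topologicalType) (f g : T -> 'rV[R]_n) :
  continuous f -> continuous g -> continuous (fun t => dot (f t) (g t)).
Proof.
move=> cf cg.
pose S s (t : T) : R := \sum_(i <- s) f t 0 i * g t 0 i.
suff cS s : continuous (S s).
  rewrite (_ : (fun t => _) = S (index_enum _)) //.
  by apply/funext => t; rewrite dotE.
elim: s => [|i s IHs].
  rewrite (_ : S [::] = fun=> 0); first exact: cst_continuous.
  by apply/funext => u; rewrite /S big_nil.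
rewrite (_ : S (i :: s) = fun t => f t 0 i * g t 0 i + S s t); last first.
  by apply/funext => u; rewrite /S big_cons.
move=> t; apply: cvgD; last exact: IHs.
by apply: cvgM;
  apply: (continuous_comp _ (@coord_continuous _ _ _ _ _ _)); [exact: cf|exact: cg].
Qed.

End Dot.

Lemma convexP (R : realType) n (A : set 'rV[R]_n) :
  convex_set A <->
  forall x y k, 0 <= k -> k <= 1 -> A x -> A y -> A (k *: x + (1 - k) *: y).
Proof.
split=> [cA x y k k0 k1 Ax Ay|cA x y l /set_mem Ax /set_mem Ay].
  have k01 : Itv.spec (@Itv.num_sem R) (Itv.Real `[0%Z, 1%Z]) k.
    by rewrite /= /Itv.num_sem /= ger0_real //= in_itv /= k0 k1.
  by have /set_mem := cA x y (Itv.mk k01) (mem_set Ax) (mem_set Ay).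
by apply/mem_set/cA.
Qed.

Lemma continuous_homothety (R : realType) n (p : 'rV[R]_n) (k : R) :
  continuous (fun x : 'rV[R]_n => (p + k *: x : 'rV[R]_n)).
Proof.
move=> x.
have cp : (fun _ : 'rV[R]_n => p) y @[y --> x] --> p.
  exact: (@cst_continuous _ 'rV[R]_n p x).
have ck : (fun y : 'rV[R]_n => k *: y) y @[y --> x] --> k *: x.
  exact: scaler_continuous.
exact: (cvgD cp ck).
Qed.

(** * Support functions and separation of three points from translates *)

Section Support.
Context {R : realType} {n : nat}.
Implicit Types (a b x y : 'rV[R]_n) (C K : set 'rV[R]_n).

Lemma continuous_dotr a : continuous (dot a).
Proof. by apply: continuous_dot; [exact: cst_continuous|move=> x; exact: cvg_id]. Qed.

Lemma compact_argmin {T : topologicalType} (f : T -> R) (A : set T) :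
  A !=set0 -> compact A -> continuous f ->
  exists2 c, A c & forall t, A t -> f c <= f t.
Proof.
move=> A0 cA cf; have [c /set_mem Ac fc] :=
  compact_EVT_min A0 cA (continuous_subspaceT cf).
by exists c => // t At; apply: fc; rewrite inE.
Qed.

Lemma dot_argmax C a : C !=set0 -> compact C ->
  exists2 c, C c & forall x, C x -> dot a x <= dot a c.
Proof.
move=> C0 cC; have [c /set_mem Cc cmax] :=
  compact_EVT_max C0 cC (continuous_subspaceT (continuous_dotr a)).
by exists c => // x Cx; apply/cmax/mem_set.
Qed.

Lemma dot_le_support C a x : C !=set0 -> compact C -> C x ->
  dot a x <= support C a.
Proof.
move=> C0 cC Cx; apply: ub_le_sup; last by exists x.
by have [c _ cmax] :=
  dot_argmax C a C0 cC; exists (dot a c) => _ [y Cy <-]; exact: cmax.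
Qed.

Lemma support_attained C a : C !=set0 -> compact C ->
  exists2 c, C c & support C a = dot a c.
Proof.
move=> C0 cC; have [c Cc cmax] := dot_argmax C a C0 cC.
exists c => //; apply/eqP; rewrite eq_le dot_le_support // andbT.
apply: ge_sup; first by exists (dot a c), c.
by move=> _ [x Cx <-]; exact: cmax.
Qed.

Lemma support_le C a k : C !=set0 -> (forall x, C x -> dot a x <= k) ->
  support C a <= k.
Proof.
move=> [x Cx] Ck; apply: ge_sup; first by exists (dot a x), x.
by move=> _ [y Cy <-]; exact: Ck.
Qed.

End Support.

Section Separation.
Context {R : realType} {n : nat}.
Implicit Types (a p x y : 'rV[R]_n) (C : set 'rV[R]_n).

(** First variation: at a minimum of a function that is quadratic along a
    segment, the one-sided derivative [u] at the start is nonnegative. *)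
Lemma quad_ge0 (u v : R) : (forall s, 0 < s -> s <= 1 -> 0 <= s * u + s ^+ 2 * v) ->
  0 <= u.
Proof.
move=> H; rewrite leNgt; apply/negP => u0.
(* for this s the quadratic term is at most half the linear one *)
pose s := Num.min 1 (- u / (2 * (`|v| + 1))).
have v1 : 0 < `|v| + 1 by rewrite ltr_wpDl.
have s0 : 0 < s by rewrite lt_min ltr01 divr_gt0 ?oppr_gt0 ?mulr_gt0.
have s1 : s <= 1 by rewrite ge_min lexx.
have su : s * (`|v| + 1) <= - u / 2.
  have : s <= - u / (2 * (`|v| + 1)) by rewrite ge_min lexx orbT.
  by rewrite invfM mulrA ler_pdivlMr.
have := H s s0 s1; rewrite expr2 -mulrA -mulrDr pmulr_rge0 // => uv.
have : s * v <= s * (`|v| + 1).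
  by rewrite ler_pM2l // (le_trans (ler_norm v)) // lerDl.
lra.
Qed.

(** Up to a factor 3, the sum of the squared distances of three points to their
    centroid: it vanishes exactly when the points coincide, and its gradient
    with respect to [y1] is twice [(y1 - y2) + (y1 - y3)]. These gradients sum
    to zero, which is what makes them usable as normals. *)
Definition spread (y1 y2 y3 : 'rV[R]_n) : R :=
  dot (y1 - y2) (y1 - y2) + dot (y1 - y3) (y1 - y3) + dot (y2 - y3) (y2 - y3).

Lemma spread12 y1 y2 y3 : spread y1 y2 y3 = spread y2 y1 y3.
Proof.
rewrite /spread !dot_bilinear !(dotC y2 y1) !(dotC y3 y1) !(dotC y3 y2).
by ring.
Qed.

Lemma spread13 y1 y2 y3 : spread y1 y2 y3 = spread y3 y2 y1.
Proof.
rewrite /spread !dot_bilinear !(dotC y2 y1) !(dotC y3 y1) !(dotC y3 y2).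
by ring.
Qed.

Lemma spread_sub y1 y2 y3 v k : spread (y1 - k *: v) y2 y3 =
  spread y1 y2 y3 - 2 * k * dot ((y1 - y2) + (y1 - y3)) v + 2 * k ^+ 2 * dot v v.
Proof.
rewrite /spread !dot_bilinear.
rewrite !(dotC y2 y1) !(dotC y3 y1) !(dotC y3 y2) !(dotC v).
by ring.
Qed.

Lemma spread_dot y1 y2 y3 : spread y1 y2 y3 =
  dot ((y1 - y2) + (y1 - y3)) y1 + dot ((y2 - y1) + (y2 - y3)) y2 +
  dot ((y3 - y1) + (y3 - y2)) y3.
Proof.
rewrite /spread !dot_bilinear !(dotC y2 y1) !(dotC y3 y1) !(dotC y3 y2).
by ring.
Qed.

Lemma spread_ge0 y1 y2 y3 : 0 <= spread y1 y2 y3.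
Proof. by rewrite !addr_ge0 ?dot_ge0. Qed.

Lemma spread_eq0 y1 y2 y3 : spread y1 y2 y3 = 0 -> y1 = y2 /\ y1 = y3.
Proof.
rewrite /spread => s0.
have [] := (dot_ge0 (y1 - y2), dot_ge0 (y1 - y3), dot_ge0 (y2 - y3)).
move=> -[q12 q13] q23.
by split; apply/subr0_eq/dot_eq0; lra.
Qed.

Lemma continuous_spread (T : topologicalType) (f g h : T -> 'rV[R]_n) :
  continuous f -> continuous g -> continuous h ->
  continuous (fun t => spread (f t) (g t) (h t)).
Proof.
move=> cf cg ch.
have cQ (u v : T -> 'rV[R]_n) : continuous u -> continuous v ->
    continuous (fun t : T => dot (u t - v t) (u t - v t)).
  move=> cu cv; have cB : continuous (fun t : T => u t - v t).
    by move=> t; exact: (cvgB (cu t) (cv t)).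
  exact: continuous_dot.
by move=> t; exact: (cvgD (cvgD (cQ _ _ cf cg t) (cQ _ _ cf ch t)) (cQ _ _ cg ch t)).
Qed.

(** First-order optimality of [c1]: the gradient at [p1 - rho *: c1] attains its
    maximum over [C] at [c1], so it is an outer normal of [C] there when
    [rho > 0]. Multiplying by [rho] covers [rho = 0] as well. *)
Lemma spread_critical C (rho : R) p1 c1 y2 y3 :
  C !=set0 -> compact C -> convex_set C -> 0 <= rho -> C c1 ->
  (forall c, C c ->
    spread (p1 - rho *: c1) y2 y3 <= spread (p1 - rho *: c) y2 y3) ->
  rho * support C ((p1 - rho *: c1 - y2) + (p1 - rho *: c1 - y3))
    <= rho * dot ((p1 - rho *: c1 - y2) + (p1 - rho *: c1 - y3)) c1.
Proof.
move=> C0 cC /convexP vC rho0 Cc1 cmin.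
set y1 := p1 - rho *: c1 in cmin *; set a := y1 - y2 + (y1 - y3).
have [d Cd ->] := support_attained C a C0 cC.
suff : 0 <= - (2 * rho * dot a (d - c1)) by rewrite dotDr dotNr; lra.
apply: (@quad_ge0 _ (2 * rho ^+ 2 * dot (d - c1) (d - c1))) => s s0 s1.
have := cmin _ (vC _ _ _ (ltW s0) s1 Cd Cc1).
rewrite (_ : p1 - _ = y1 - (s * rho) *: (d - c1)); last first.
  by apply/rowP => i; rewrite !mxE; ring.
rewrite (spread_sub y1) -subr_ge0 -/y1 -/a; congr (0 <= _); ring.
Qed.

(** Translates of [rho *: C] through the three points correspond to zeros of the
    spread of the points [pi - rho *: ci]. When there is none, the gradients
    at a minimiser over [C ^ 3] are the separating normals, and the excess of
    the right side over the left is the spread itself. *)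
Lemma translate_separation C (rho : R) p1 p2 p3 :
  C !=set0 -> compact C -> convex_set C -> 0 <= rho ->
  ~ (exists t, [/\ [set t + rho *: x | x in C] p1,
        [set t + rho *: x | x in C] p2 & [set t + rho *: x | x in C] p3]) ->
  exists a1 a2 a3, a1 + a2 + a3 = 0 /\
    rho * (support C a1 + support C a2 + support C a3) <
    dot a1 p1 + dot a2 p2 + dot a3 p3.
Proof.
move=> C0 cC vC rho0 far.
pose F (c : 'rV[R]_n * 'rV[R]_n * 'rV[R]_n) :=
  spread (p1 - rho *: c.1.1) (p2 - rho *: c.1.2) (p3 - rho *: c.2).
have cy (p : 'rV[R]_n) : continuous (fun c : 'rV[R]_n => (p - rho *: c : 'rV[R]_n)).
  rewrite (_ : (fun c => _) = fun c => p + (- rho) *: c).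
    exact: continuous_homothety.
  by apply/funext => c; rewrite scaleNr.
have [|||[[c1 c2] c3] [[/= Cc1 Cc2] Cc3] cmin] :=
  compact_argmin F (C `*` C `*` C).
- by case: C0 => c Cc; exists (c, c, c).
- by apply: compact_setX => //; exact: compact_setX.
- apply: continuous_spread.
  + exact: (continuousT_comp (continuousT_comp continuous_fst continuous_fst) (cy p1)).
  + exact: (continuousT_comp (continuousT_comp continuous_fst continuous_snd) (cy p2)).
  + exact: (continuousT_comp continuous_snd (cy p3)).
have := @spread_critical C rho p1 c1 (p2 - rho *: c2) (p3 - rho *: c3) C0 cC vC rho0 Cc1.
have := @spread_critical C rho p2 c2 (p1 - rho *: c1) (p3 - rho *: c3) C0 cC vC rho0 Cc2.
have := @spread_critical C rho p3 c3 (p1 - rho *: c1) (p2 - rho *: c2) C0 cC vC rho0 Cc3.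
have h1 c : C c -> F (c1, c2, c3) <= F (c, c2, c3) by move=> Cc; apply: cmin.
have h2 c : C c -> F (c1, c2, c3) <= F (c1, c, c3) by move=> Cc; apply: cmin.
have h3 c : C c -> F (c1, c2, c3) <= F (c1, c2, c) by move=> Cc; apply: cmin.
move: h1 h2 h3; rewrite /F /=.
have e1 : p1 = p1 - rho *: c1 + rho *: c1 by rewrite subrK.
have e2 : p2 = p2 - rho *: c2 + rho *: c2 by rewrite subrK.
have e3 : p3 = p3 - rho *: c3 + rho *: c3 by rewrite subrK.
have spos : 0 < spread (p1 - rho *: c1) (p2 - rho *: c2) (p3 - rho *: c3).
  rewrite lt_neqAle spread_ge0 andbT eq_sym; apply/eqP => /spread_eq0[e12 e13].
  apply: far; exists (p1 - rho *: c1).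
  split; first by exists c1 => //; rewrite -e1.
    by exists c2 => //; rewrite e12 -e2.
  by exists c3 => //; rewrite e13 -e3.
rewrite spread_dot in spos; move: spos.
set y1 := p1 - rho *: c1 in e1 *; set y2 := p2 - rho *: c2 in e2 *.
set y3 := p3 - rho *: c3 in e3 *.
set a1 := y1 - y2 + (y1 - y3); set a2 := y2 - y1 + (y2 - y3).
set a3 := y3 - y1 + (y3 - y2).
move=> spos h1 h2 h3 s3 s2 s1.
have {}s1 := s1 h1.
have {}s2 : rho * support C a2 <= rho * dot a2 c2.
  by apply: s2 => c Cc; rewrite -/y2 spread12 (spread12 _ y1); exact: h2.
have {}s3 : rho * support C a3 <= rho * dot a3 c3.
  by apply: s3 => c Cc; rewrite spread13 spread12 [leRHS]spread13 [leRHS]spread12;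
    exact: h3.
exists a1, a2, a3; split; first by apply/rowP => i; rewrite !mxE; ring.
rewrite e1 e2 e3 (dotDr a1) (dotDr a2) (dotDr a3) !dotZr.
by move: (spos); rewrite -/a1 -/a2 -/a3; lra.
Qed.

End Separation.

(** * Helly's theorem in the plane *)

Section Helly.
Context {R : realType}.

Lemma convex_weighted_sum n (A : set 'rV[R]_n) (I : Type) (r : seq I)
    (P : pred I) (w : I -> R) (x : I -> 'rV[R]_n) :
  convex_set A -> A !=set0 -> (forall i, P i -> 0 <= w i) ->
  (forall i, P i -> A (x i)) ->
  exists2 y, A y &
    \sum_(i <- r | P i) w i *: x i = (\sum_(i <- r | P i) w i) *: y.
Proof.
move=> /convexP vA [a Aa] w0 Ax; elim: r => [|i r [y Ay IH]].
  by exists a; rewrite ?big_nil ?scale0r.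
rewrite !big_cons; case: ifPn => Pi; last by exists y.
have W0 : 0 <= \sum_(j <- r | P j) w j by exact: sumr_ge0.
have wi0 := w0 i Pi; rewrite IH; set W := \sum_(j <- r | P j) w j in W0 *.
have [s0|s0] := eqVneq (w i + W) 0.
  exists a => //; rewrite s0.
  have [-> ->] : w i = 0 /\ W = 0 by lra.
  by rewrite !scale0r addr0.
have s1 : 0 < w i + W by rewrite lt_neqAle eq_sym s0 addr_ge0.
exists (w i / (w i + W) *: x i + (1 - w i / (w i + W)) *: y).
  by apply: vA => //; [rewrite divr_ge0 // addr_ge0|
    rewrite ler_pdivrMr // mul1r lerDl|exact: Ax].
rewrite scalerDr !scalerA; congr (_ *: _ + _ *: _); field; exact: s0.
Qed.

(** The [n.+2] rows [(x i, 1)] have only [n + 1] columns, so they are linearly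
    dependent. *)
Lemma affine_dependence n (x : 'I_n.+2 -> 'rV[R]_n) :
  exists l : 'I_n.+2 -> R, [/\ exists i, l i != 0, \sum_i l i = 0 &
    \sum_i l i *: x i = 0].
Proof.
pose M : 'M[R]_(n.+2, n + 1) := row_mx (\matrix_(i < n.+2) x i) (const_mx 1).
have /rowV0Pn[l lM l0] : kermx M != 0.
  rewrite -mxrank_eq0 mxrank_ker -lt0n subn_gt0.
  by apply: leq_ltn_trans (rank_leq_col M) _; rewrite addn1.
move: lM => /sub_kermxP; rewrite mul_mx_row -[RHS]row_mx0 => /eq_row_mx[lx l1].
exists (fun i => l 0 i); split.
- by move/eqP/rowP : l0 => /existsNP[i /eqP]; rewrite mxE => ?; exists i.
- move/matrixP/(_ 0 0) : l1; rewrite !mxE => e; rewrite -[RHS]e.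
  by apply: eq_bigr => i _; rewrite mxE mulr1.
- move: lx; rewrite mulmx_sum_row => e; rewrite -[RHS]e.
  by apply: eq_bigr => i _; rewrite rowK.
Qed.

(** Radon's argument: split an affine dependence between the points [x i] by
    sign. Both sides describe the same point, which lies in each [F j] because
    [j] is absent from at least one of the two sides. *)
Lemma helly_step n (F : 'I_n.+2 -> set 'rV[R]_n) :
  (forall i, convex_set (F i)) ->
  (forall i, exists x, forall j, j != i -> F j x) ->
  exists x, forall j, F j x.
Proof.
move=> vF /choice[x xF].
have [l [[k lk0] l1 lx]] := affine_dependence n x.
have F0 j : F j !=set0 by exists (x (lift j ord0)); apply: xF; exact: neq_lift.
pose s := \sum_(i | 0 < l i) l i.
have sN : s = \sum_(i | ~~ (0 < l i)) - l i.
  by rewrite sumrN; move/eqP: l1; rewrite (bigID (fun i => 0 < l i)) addr_eq0 => /eqP.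
have s0 : 0 < s.
  rewrite lt_neqAle eq_sym sumr_ge0 ?andbT => [|i /ltW//].
  apply/eqP => s0; move: lk0; apply/negP; rewrite negbK.
  have [lk|lk] := boolP (0 < l k).
    have /psumr_eq0P : s = 0 by []. by move=> -> // i /ltW.
  have /psumr_eq0P sk : \sum_(i | ~~ (0 < l i)) - l i = 0 by rewrite -sN.
  by rewrite -oppr_eq0 sk // => i; rewrite -leNgt oppr_ge0.
have xN : \sum_(i | 0 < l i) l i *: x i = \sum_(i | ~~ (0 < l i)) - l i *: x i.
  under [RHS]eq_bigr do rewrite scaleNr.
  by rewrite sumrN; move/eqP: lx; rewrite (bigID (fun i => 0 < l i)) addr_eq0 => /eqP.
exists (s^-1 *: \sum_(i | 0 < l i) l i *: x i) => j.
have [lj|lj] := boolP (0 < l j).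
  rewrite xN; have [i|i li|y Fy ->] :=
    convex_weighted_sum n (F j) _ (index_enum 'I_n.+2)
      (fun i => ~~ (0 < l i)) (fun i => - l i) x (vF j) (F0 j).
  - by rewrite -leNgt oppr_ge0.
  - by apply: xF; apply: contraNneq li => <-.
  - by rewrite -sN scalerA mulVf ?scale1r // gt_eqF.
have [i|i li|y Fy ->] := convex_weighted_sum n (F j) _ (index_enum 'I_n.+2)
      (fun i => 0 < l i) l x (vF j) (F0 j).
- exact: ltW.
- by apply: xF; apply: contraNneq lj => ->.
- by rewrite scalerA mulVf ?scale1r // gt_eqF.
Qed.

(** The case of four planar sets, phrased with intersections so that a partial
    intersection can be used as one of the four sets. *)
Lemma helly4 (A B C D : set 'rV[R]_2) :
  convex_set A -> convex_set B -> convex_set C -> convex_set D ->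
  A `&` B `&` C !=set0 -> A `&` B `&` D !=set0 ->
  A `&` C `&` D !=set0 -> B `&` C `&` D !=set0 ->
  A `&` B `&` C `&` D !=set0.
Proof.
move=> vA vB vC vD [d [[dA dB] dC]] [c [[cA cB] cD]] [b [[bA bC] bD]] [a [[aB aC] aD]].
have [|i|x xF] := helly_step 2 (fun i => nth setT [:: A; B; C; D] i).
- by case=> -[|[|[|[|]]]].
- case: i => -[|[|[|[|//]]]] ?; [exists a|exists b|exists c|exists d];
    by case=> -[|[|[|[|//]]]].
- by exists x; split; [split; [split|]|];
    [exact: (xF (@Ordinal 4 0 isT))|exact: (xF (@Ordinal 4 1 isT))|
     exact: (xF (@Ordinal 4 2 isT))|exact: (xF (@Ordinal 4 3 isT))].
Qed.

(** A finite intersection is kept together with the property that it still meets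
    every [G i `&` G j]; adding one more set preserves this by [helly4].
    Compactness then passes to arbitrary families. *)
Lemma helly_plane (I : choiceType) (D : set I) (G : I -> set 'rV[R]_2) :
  (forall i, D i -> convex_set (G i)) -> (forall i, D i -> compact (G i)) ->
  (forall i j k, D i -> D j -> D k -> G i `&` G j `&` G k !=set0) ->
  \bigcap_(i in D) G i !=set0.
Proof.
move=> vG cG G3.
have [D0|/set0P[i0 Di0]] := eqVneq D set0.
  by exists 0 => i; rewrite D0.
(* meeting every pair G i, G j is what allows one more set to be added *)
have good (s : seq I) : {in s, forall i, D i} -> forall i j, D i -> D j ->
    [set x | {in s, forall k, G k x}] `&` G i `&` G j !=set0.
  elim: s => [|k s IHs] sD i j Di Dj.
    by have [x [[Gx _] Gx']] := G3 i i j Di Di Dj; exists x; split => //; split.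
  have Dk : D k by apply: sD; rewrite inE eqxx.
  have {}sD : {in s, forall i, D i} by move=> l ls; apply: sD; rewrite inE ls orbT.
  have [|x [[[Qx Gkx] Gix] Gjx]] :=
    helly4 [set x | {in s, forall k, G k x}] (G k) (G i) (G j) _
      (vG _ Dk) (vG _ Di) (vG _ Dj) (IHs sD _ _ Dk Di) (IHs sD _ _ Dk Dj)
      (IHs sD _ _ Di Dj) (G3 _ _ _ Dk Di Dj).
    apply/convexP => x y t t0 t1 Qx Qy l ls.
    by have /convexP := vG l (sD l ls); apply => //; [exact: Qx|exact: Qy].
  exists x; split => //; split => // l; rewrite inE => /predU1P[->//|]; exact: Qx.
have := cG _ Di0; rewrite compact_In0 => /(_ I D (fun i => G i0 `&` G i)).
case.
- exists G => // i Di; apply: compact_closed; last exact: cG.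
  exact: norm_hausdorff.
- move=> E ED; have [|x [[Qx Gx] _]] := good (finmap.enum_fset E) _ i0 i0 Di0 Di0.
    by move=> i iE; apply/set_mem/ED.
  by exists x => i /= iE; split => //; exact: Qx.
- by move=> x xG; exists x => i Di; have [] := xG i Di.
Qed.

End Helly.

(** * The inequality for three points *)

Section Sublinear.
Context {R : realType} {n : nat}.
Implicit Types (a b u x y : 'rV[R]_n) (C K : set 'rV[R]_n).

Lemma support_ge0 C a : compact C -> C 0 -> 0 <= support C a.
Proof.
by move=> cC C0; rewrite -[leLHS](dot0r a); apply: dot_le_support => //; exists 0.
Qed.

Lemma supportD C a b : C !=set0 -> compact C ->
  support C (a + b) <= support C a + support C b.
Proof.
by move=> C0 cC; apply: support_le => // x Cx; rewrite dotDl lerD ?dot_le_support.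
Qed.

Lemma support0 C : C !=set0 -> compact C -> support C 0 = 0.
Proof. by move=> C0 cC; have [c _ ->] :=
  support_attained C 0 C0 cC; rewrite dot0l. Qed.

Lemma supportZ C k a : C !=set0 -> compact C -> 0 <= k ->
  support C (k *: a) = k * support C a.
Proof.
move=> C0 cC k0; apply/eqP; rewrite eq_le; apply/andP; split.
  by apply: support_le => // x Cx; rewrite dotZl ler_wpM2l ?dot_le_support.
by have [c Cc ->] := support_attained C a C0 cC; rewrite -dotZl dot_le_support.
Qed.

(** The support function of the convex hull of [C] and [- C] when [0] is in [C];
    that hull is the unit ball of the norm measuring the maximum diameter. *)
Definition sym_support C u : R := Num.max (support C u) (support C (- u)).

Lemma norm_dot_le_sym_support C u x : compact C -> C x -> `|dot u x| <= sym_support C u.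
Proof.
move=> cC Cx; have C0 : C !=set0 by exists x.
by rewrite ler_norml lerNl -dotNl /sym_support !le_max !dot_le_support ?orbT.
Qed.

(** The diameter bound stated directly on pairs of points and without a quotient,
    so that the direction [0] causes no exception. *)
Definition diam_le K C D := forall u p q, K p -> K q ->
  dot u (p - q) <= D * sym_support C u.

End Sublinear.

Section KeyInequality.
Context {R : realType} {n : nat}.
Implicit Types (K C : set 'rV[R]_n) (a p : 'rV[R]_n).

Lemma opp_of_sum0 {a1 a2 a3} : a1 + a2 + a3 = 0 -> a1 = - (a2 + a3).
Proof. by move/eqP; rewrite -addrA addr_eq0 => /eqP. Qed.

(** The expansion behind the constant 3/2: unlike the symmetric expansions, it
    weights the direction [a1] twice, and [a1] will carry the largest value
    of the support function. *)
Lemma dot_triple a1 a2 a3 p1 p2 p3 : a1 + a2 + a3 = 0 ->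
  2 * (dot a1 p1 + dot a2 p2 + dot a3 p3) =
  dot a1 (p1 - p2) + dot a1 (p1 - p3) + dot (a2 - a3) (p2 - p3).
Proof. by move/opp_of_sum0 ->; rewrite !dot_bilinear; ring. Qed.

Lemma sym_support_sum0 C a1 a2 a3 : compact C -> C 0 -> a1 + a2 + a3 = 0 ->
  sym_support C a1 <= Num.max (support C a1) (support C a2 + support C a3).
Proof.
move=> cC C0 a0; have nC : C !=set0 by exists 0.
rewrite /sym_support {2}(opp_of_sum0 a0) opprK ge_max !le_max lexx supportD //.
by rewrite orbT.
Qed.

Lemma sym_support_sub_sum0 C a1 a2 a3 : compact C -> C 0 -> a1 + a2 + a3 = 0 ->
  sym_support C (a2 - a3) <=
  support C a1 + 2 * Num.max (support C a2) (support C a3).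
Proof.
move=> cC C0 a0; have nC : C !=set0 by exists 0.
have hh b : support C (a1 + (b + b)) <= support C a1 + 2 * support C b.
  by apply: le_trans (supportD _ _ _ nC cC) _;
    rewrite lerD2l mulr2n mulrDl !mul1r supportD.
rewrite /sym_support opprB; have := opp_of_sum0 a0.
move=> a1E; rewrite ge_max; apply/andP; split.
  rewrite (_ : a2 - a3 = a1 + (a2 + a2)).
    by apply: le_trans (hh a2) _; rewrite lerD2l ler_pM2l // le_max lexx.
  by rewrite a1E; apply/rowP => i; rewrite !mxE; ring.
rewrite (_ : a3 - a2 = a1 + (a3 + a3)).
  by apply: le_trans (hh a3) _; rewrite lerD2l ler_pM2l // le_max lexx orbT.
by rewrite a1E; apply/rowP => i; rewrite !mxE; ring.
Qed.

Lemma triple_le K C D a1 a2 a3 p1 p2 p3 :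
  compact C -> C 0 -> 0 <= D -> diam_le K C D -> K p1 -> K p2 -> K p3 ->
  a1 + a2 + a3 = 0 ->
  support C a2 <= support C a1 -> support C a3 <= support C a1 ->
  dot a1 p1 + dot a2 p2 + dot a3 p3 <=
  3 / 2 * D * (support C a1 + support C a2 + support C a3).
Proof.
move=> cC C0 D0 KD K1 K2 K3 a0 h21 h31.
have X1 := KD a1 _ _ K1 K2; have X2 := KD a1 _ _ K1 K3.
have X3 := KD (a2 - a3) _ _ K2 K3.
have g1 := sym_support_sum0 C _ _ _ cC C0 a0.
have g2 := sym_support_sub_sum0 C _ _ _ cC C0 a0.
have := dot_triple _ _ _ p1 p2 p3 a0.
have P1 := support_ge0 C a1 cC C0.
have P2 := support_ge0 C a2 cC C0.
have P3 := support_ge0 C a3 cC C0.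
suff : D * (2 * sym_support C a1 + sym_support C (a2 - a3)) <=
   D * (3 * (support C a1 + support C a2 + support C a3)) by lra.
apply: ler_wpM2l => //.
by move: g1 g2; case: (leP (support C a1)); case: (leP (support C a2)); lra.
Qed.

(** When the bound of [triple_le] is attained, the slack
    [h a2 + h a3 + 2 min (h a2) (h a3)] in the case [h a1 >= h a2 + h a3] must
    vanish, and the other case leaves positive slack. *)
Lemma triple_eq K C D a1 a2 a3 p1 p2 p3 :
  compact C -> C 0 -> 0 < D -> diam_le K C D -> K p1 -> K p2 -> K p3 ->
  a1 + a2 + a3 = 0 ->
  support C a2 <= support C a1 -> support C a3 <= support C a1 ->
  0 < support C a1 ->
  3 / 2 * D * (support C a1 + support C a2 + support C a3) <=
  dot a1 p1 + dot a2 p2 + dot a3 p3 ->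
  [/\ support C a2 = 0, support C a3 = 0,
    dot a1 (p1 - p2) = D * support C a1,
    dot a1 (p1 - p3) = D * support C a1 &
    dot (a2 - a3) (p2 - p3) = D * support C a1].
Proof.
move=> cC C0 D0 KD K1 K2 K3 a0 h21 h31 h1 big.
have X1 := KD a1 _ _ K1 K2; have X2 := KD a1 _ _ K1 K3.
have X3 := KD (a2 - a3) _ _ K2 K3.
have g1 := sym_support_sum0 C _ _ _ cC C0 a0.
have g2 := sym_support_sub_sum0 C _ _ _ cC C0 a0.
have dt := dot_triple _ _ _ p1 p2 p3 a0.
have P2 := support_ge0 C a2 cC C0.
have P3 := support_ge0 C a3 cC C0.
have : D * (3 * (support C a1 + support C a2 + support C a3)) <=
  D * (2 * sym_support C a1 + sym_support C (a2 - a3)) by lra.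
rewrite ler_pM2l // => le3.
have [h2 h3] : support C a2 = 0 /\ support C a3 = 0.
  by move: g1 g2; case: (leP (support C a1)); case: (leP (support C a2)); lra.
rewrite h2 h3 maxxx addr0 mulr0 addr0 in g1 g2 le3 big *.
have {}g1 : D * sym_support C a1 <= D * support C a1.
  by rewrite ler_pM2l // (le_trans g1) // ge_max lexx ltW.
have {}g2 : D * sym_support C (a2 - a3) <= D * support C a1 by rewrite ler_pM2l.
by split => //; lra.
Qed.

End KeyInequality.

Section Plane.
Context {R : realType}.
Implicit Types (K C : set 'rV[R]_2) (a d e p q x y z : 'rV[R]_2).

Lemma dot2E a x : dot a x = a 0 0 * x 0 0 + a 0 1 * x 0 1.
Proof. by rewrite dotE big_ord_recl big_ord1; congr (_ + a 0 _ * x 0 _);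
  exact/val_inj. Qed.

Lemma row2P x y : x 0 0 = y 0 0 -> x 0 1 = y 0 1 -> x = y.
Proof.
move=> e0 e1; apply/rowP => -[[|[|//]] i2].
  by rewrite (_ : Ordinal i2 = 0) //; exact/val_inj.
by rewrite (_ : Ordinal i2 = 1) //; exact/val_inj.
Qed.

Definition cross x y : R := x 0 0 * y 0 1 - x 0 1 * y 0 0.

(** The Cauchy-Binet identity. *)
Lemma cross_dot a b d e :
  cross a b * cross d e = dot a d * dot b e - dot a e * dot b d.
Proof. by rewrite !dot2E /cross; ring. Qed.

Lemma dot_sep a b z : cross a b != 0 -> dot a z = 0 -> dot b z = 0 -> z = 0.
Proof.
move=> ab0 az bz.
have z0 : cross a b * z 0 0 = b 0 1 * dot a z - a 0 1 * dot b z.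
  by rewrite !dot2E /cross; ring.
have z1 : cross a b * z 0 1 = a 0 0 * dot b z - b 0 0 * dot a z.
  by rewrite !dot2E /cross; ring.
rewrite az bz !mulr0 subr0 in z0 z1.
apply: row2P; rewrite mxE.
  by move/eqP: z0; rewrite mulf_eq0 (negbTE ab0) => /eqP.
by move/eqP: z1; rewrite mulf_eq0 (negbTE ab0) => /eqP.
Qed.

(** The functional [u] below is [a - b], up to a tilt, and takes the value
    [D * h] at [k - k'] whatever the tilt. If the vertex [a = - h], [b = 0] of
    the triangle is missing from [C], then [- a < h] throughout [C], and
    putting slightly more weight on [a] makes both [u] and [- u] smaller than
    [h] on [C], against the diameter bound. *)
Lemma extremal_vertex K C D a b (h : R) k k' :
  C !=set0 -> compact C -> 0 < D -> diam_le K C D -> 0 < h -> K k -> K k' ->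
  (forall x, C x -> dot a x <= 0) -> (forall x, C x -> dot b x <= 0) ->
  (forall x, C x -> - dot (a + b) x <= h) ->
  dot a (k - k') = D * h / 2 -> dot b (k - k') = - (D * h / 2) ->
  exists p, [/\ C p, dot a p = - h & dot b p = 0].
Proof.
move=> C0 cC D0 KD h0 Kk Kk' Ca Cb Cab ak bk.
have [p Cp pmax] := dot_argmax C (- a) C0 cC.
have bp := Cb p Cp; have abp := Cab p Cp; have ap := Ca p Cp.
rewrite dotDl in abp.
have [hp|hp] := eqVneq (dot a p) (- h); first by exists p; split => //; lra.
exfalso; pose Y := - dot a p.
have Yh : Y < h.
  by rewrite lt_neqAle; apply/andP; split;
    [apply: contra_neq hp => <-; rewrite opprK|rewrite /Y; lra].
have Y0 : 0 <= Y by rewrite oppr_ge0.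
(* small enough that (1 + dl) * Y < h *)
pose dl := (h - Y) / (2 * h).
have dl0 : 0 < dl by rewrite divr_gt0 ?subr_gt0 ?mulr_gt0.
have dlh : dl * h = (h - Y) / 2 by rewrite /dl; field; rewrite gt_eqF.
have dl1 : dl <= 1 / 2 by rewrite -(ler_pM2r h0) dlh; lra.
pose u := (1 + dl) *: a - (1 - dl) *: b.
have := KD u k k' Kk Kk'.
rewrite {1}/u dotDl dotNl !dotZl ak bk.
rewrite (_ : _ - _ = D * h); last by field.
rewrite ler_pM2l // leNgt => /negP; apply.
rewrite /sym_support gt_max; apply/andP; split.
  have [c Cc ->] := support_attained C u C0 cC.
  have := Ca c Cc; have := Cb c Cc; have := Cab c Cc.
  rewrite /u !dotDl dotNl !dotZl => abc bc ac.
  have : (1 + dl) * dot a c <= 0 by rewrite pmulr_rle0 //; lra.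
  have : (1 - dl) * - dot b c <= (1 - dl) * h by rewrite ler_wpM2l //; lra.
  have : 0 < dl * h by rewrite mulr_gt0.
  lra.
have [c Cc ->] := support_attained C (- u) C0 cC.
have := Ca c Cc; have := Cb c Cc; have := pmax c Cc.
rewrite /u !dotNl !dotDl !dotNl !dotZl => ac bc ac'.
have : (1 - dl) * dot b c <= 0 by rewrite pmulr_rle0 //; lra.
have : (1 + dl) * - dot a c <= (1 + dl) * Y by rewrite ler_wpM2l //; rewrite /Y; lra.
have : dl * Y <= dl * h by rewrite ler_wpM2l //; lra.
lra.
Qed.

End Plane.

(** * The triangle forced by equality *)

Section Triangle.
Context {R : realType}.

(** Barycentric coordinates, the weight of the vertex [0] being left out. *)
Lemma convex_hull_triangle n (p q : 'rV[R]_n) :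
  convex_hull [set 0; p; q] =
  [set x | exists s t : R, [/\ 0 <= s, 0 <= t, s + t <= 1 & x = s *: p + t *: q]].
Proof.
apply/seteqP; split.
  apply: smallest_sub.
    apply/convexP => _ _ k k0 k1 [s [t [s0 t0 st ->]]] [s' [t' [s'0 t'0 st' ->]]].
    have k1' : 0 <= 1 - k by rewrite subr_ge0.
    exists (k * s + (1 - k) * s'), (k * t + (1 - k) * t'); split.
    - by rewrite addr_ge0 ?mulr_ge0.
    - by rewrite addr_ge0 ?mulr_ge0.
    - have := ler_wpM2l k0 st; have := ler_wpM2l k1' st'; lra.
    - by apply/rowP => i; rewrite !mxE; ring.
  move=> _ [[->|->]|->].
  - by exists 0, 0; rewrite !scale0r addr0 lexx addr0 ler01.
  - by exists 1, 0; rewrite scale0r scale1r !addr0 lexx ler01.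
  - by exists 0, 1; rewrite scale0r scale1r !add0r lexx ler01.
move=> _ [s [t [s0 t0 st ->]]] D [/convexP vD DS].
have D0 : D 0 by apply: DS; left; left.
have Dp : D p by apply: DS; left; right.
have Dq : D q by apply: DS; right.
have [e|ne] := eqVneq (s + t) 0.
  have [-> ->] : s = 0 /\ t = 0 by lra.
  by rewrite !scale0r addr0.
have pos : 0 < s + t by rewrite lt_neqAle eq_sym ne addr_ge0.
have := vD _ _ (s + t) (ltW pos) st (vD p q (s / (s + t)) _ _ Dp Dq) D0.
rewrite (_ : _ + _ = s *: p + t *: q).
  by apply; [rewrite divr_ge0 // ltW|rewrite ler_pdivrMr // mul1r lerDl].
by rewrite scaler0 addr0 scalerDr !scalerA; congr (_ *: _ + _ *: _); field.
Qed.

(** Rigidity when [a1] carries the largest support value. The equalities of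
    [triple_eq] give the values of [a2] and [a3] on [p2 - p3] and determine
    their sum on [p1 - p2]; this makes [a2], [a3] a basis of the dual plane, in
    which [C] is squeezed between the triangle and its three vertices. *)
Lemma extremal_triangle (K C : set 'rV[R]_2) (D : R) (a1 a2 a3 p1 p2 p3 : 'rV[R]_2) :
  convex_body C -> C 0 -> 0 < D -> diam_le K C D -> K p1 -> K p2 -> K p3 ->
  a1 + a2 + a3 = 0 ->
  support C a2 <= support C a1 -> support C a3 <= support C a1 ->
  0 < support C a1 ->
  3 / 2 * D * (support C a1 + support C a2 + support C a3) <=
  dot a1 p1 + dot a2 p2 + dot a3 p3 ->
  exists p q, triangle 0 p q C.
Proof.
move=> [C0 cC vC] C00 D0 KD K1 K2 K3 a0 h21 h31 h10 big.
have [h2 h3 X1 X2 X3] :=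
  triple_eq K C D _ _ _ _ _ _ cC C00 D0 KD K1 K2 K3 a0 h21 h31 h10 big.
set h := support C a1 in h10 X1 X2 X3.
have Ca2 x : C x -> dot a2 x <= 0 by move=> Cx; rewrite -h2 dot_le_support.
have Ca3 x : C x -> dot a3 x <= 0 by move=> Cx; rewrite -h3 dot_le_support.
have Ca1 x : C x -> - dot (a2 + a3) x <= h.
  by move=> Cx; rewrite -dotNl -(opp_of_sum0 a0) dot_le_support.
have a1E := opp_of_sum0 a0.
have s23 : dot (a2 + a3) (p2 - p3) = 0.
  rewrite -[_ + _]opprK -a1E dotNl; apply/eqP; rewrite oppr_eq0; apply/eqP.
  by move: X1 X2; rewrite !dotDr !dotNr; lra.
have d2 : dot a2 (p2 - p3) = D * h / 2.
  by move: s23 X3; rewrite !dotDl dotNl; lra.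
have d3 : dot a3 (p2 - p3) = - (D * h / 2).
  by move: s23 X3; rewrite !dotDl dotNl; lra.
have cr : cross a2 a3 != 0.
  (* only the sum of the unknown values of a2 and a3 on p1 - p2 matters *)
  have := cross_dot a2 a3 (p2 - p3) (p1 - p2); rewrite d2 d3.
  have : dot a2 (p1 - p2) + dot a3 (p1 - p2) = - (D * h).
    by rewrite -X1 a1E dotNl opprK dotDl.
  move=> e.
  have -> : D * h / 2 * dot a3 (p1 - p2) - dot a2 (p1 - p2) * - (D * h / 2) =
      - (D * h) ^+ 2 / 2.
    have -> : dot a2 (p1 - p2) = - (D * h) - dot a3 (p1 - p2) by lra.
    by field.
  move=> e2; apply/eqP => c0; move: e2; rewrite c0 mul0r => /esym/eqP.
  by rewrite !mulf_eq0 oppr_eq0 sqrf_eq0 mulf_eq0 invr_eq0 pnatr_eq0 !gt_eqF.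
have [p [Cp a2p a3p]] :=
  extremal_vertex K C D _ _ h _ _ C0 cC D0 KD h10 K2 K3 Ca2 Ca3 Ca1 d2 d3.
have Ca1' x : C x -> - dot (a3 + a2) x <= h by rewrite addrC; exact: Ca1.
have [||q [Cq a3q a2q]] :=
  extremal_vertex K C D _ _ h _ _ C0 cC D0 KD h10 K3 K2 Ca3 Ca2 Ca1'.
- by rewrite -opprB dotNr d3 opprK.
- by rewrite -opprB dotNr d2.
exists p, q; split.
  rewrite !subr0 free_cons span_seq1 seq1_free; apply/andP; split.
    apply/negP => /vlineP[k pk]; move: a2p; rewrite pk dotZr a2q mulr0 => /esym/eqP.
    by rewrite oppr_eq0 gt_eqF.
  by apply: contraTneq h10 => q0; rewrite -[h]opprK -a3q q0 dot0r oppr0 ltxx.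
apply/seteqP; split.
  rewrite convex_hull_triangle => x Cx.
  (* (p, q) is dual to (- a2 / h, - a3 / h) *)
  exists (- dot a2 x / h), (- dot a3 x / h); split.
  - by rewrite divr_ge0 ?(ltW h10) // oppr_ge0 Ca2.
  - by rewrite divr_ge0 ?(ltW h10) // oppr_ge0 Ca3.
  - by rewrite -mulrDl ler_pdivrMr // mul1r -opprD -dotDl Ca1.
  - apply/eqP; rewrite -subr_eq0; apply/eqP; apply: (dot_sep _ _ _ cr).
      by rewrite !dot_bilinear a2p a2q; field; rewrite gt_eqF.
    by rewrite !dot_bilinear a3p a3q; field; rewrite gt_eqF.
by apply: smallest_sub => // _ [[->|->]|->].
Qed.

End Triangle.

(** * Bounds on the maximum diameter *)

Section Bounds.
Context {R : realType}.
Implicit Types K C : set 'rV[R]_2.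

(** Otherwise [C] would lie in the kernel of [a], a flat of smaller dimension. *)
Lemma full_dim_dot_neq0 C (a : 'rV[R]_2) : C 0 -> has_dim C 2 -> a != 0 ->
  exists2 x, C x & dot a x != 0.
Proof.
move=> C0 [p [U [CU dU]]] a0; apply: contrapT => H.
have Ca x : C x -> dot a x = 0.
  by move=> Cx; apply: contrapT => /eqP ax; apply: H; exists x.
have UE : U = fullv.
  by apply/eqP; rewrite eqEdim subvf dU dimvf /dim /= mul1n.
pose V := lker (linfun (mulmxr a^T : 'rV[R]_2 -> 'rV[R]_1)).
have VP x : (x \in V) = (dot a x == 0).
  rewrite memv_ker lfunE /= dotC /dot; apply/eqP/eqP => [->|x0]; first by rewrite mxE.
  by apply/rowP => i; rewrite ord1 x0 mxE.
have : affine_hull C `<=` flat 0 V.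
  apply: smallest_sub; first by exists 0, V.
  by move=> x Cx; exists x; rewrite ?add0r //= VP Ca.
rewrite CU => /(_ a)[|v /=].
  by exists (a - p); [rewrite /= UE memvf|rewrite addrC subrK].
rewrite VP add0r => /eqP av va; move: a0; rewrite va in av.
by rewrite (dot_eq0 _ av) eqxx.
Qed.

Lemma sym_support_gt0 C u : compact C -> C 0 -> has_dim C 2 -> u != 0 -> 0 < sym_support C u.
Proof.
move=> cC C0 dC u0; have [x Cx ux] := full_dim_dot_neq0 _ _ C0 dC u0.
by apply: lt_le_trans (norm_dot_le_sym_support C u x cC Cx); rewrite normr_gt0.
Qed.

Lemma width_ge K (u k k' : 'rV[R]_2) : compact K -> K k -> K k' ->
  dot u (k - k') <= support K u + support K (- u).
Proof.
move=> cK Kk Kk'; have K0 : K !=set0 by exists k.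
by rewrite dotDr dotNr -dotNl lerD ?dot_le_support.
Qed.

(** Rotation by a quarter turn; it turns [cross] into a dot product. *)
Definition quarter (v : 'rV[R]_2) : 'rV[R]_2 :=
  \row_i (if i == 0 then v 0 1 else - v 0 0).

Lemma dot_quarter v z : dot (quarter v) z = cross z v.
Proof. by rewrite dot2E /cross !mxE /=; ring. Qed.

(** Two independent vectors [v1], [v2] of [C] bound the denominator below by
    [|u . v1|] and [|u . v2|], while Cramer's rule writes [k - k'] in terms of
    [v1] and [v2] with coefficients bounded over [K]. *)
Lemma has_sup_DMAX K C : convex_body K -> convex_body C -> C 0 -> has_dim C 2 ->
  has_sup [set (support K u + support K (- u)) /
           Num.max (support C u) (support C (- u)) | u in [set u | u != 0]].
Proof.
move=> [K0 cK _] [_ cC _] C0 dC.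
have e0 : (delta_mx 0 0 : 'rV[R]_2) != 0.
  by apply/eqP => /rowP/(_ 0); rewrite !mxE !eqxx => /eqP; rewrite oner_eq0.
split.
  by eexists; exists (delta_mx 0 0) => //; exact: e0.
have [v1 Cv1 v10] := full_dim_dot_neq0 _ _ C0 dC e0.
have r0 : quarter v1 != 0.
  apply: contraNneq v10 => r0; rewrite (_ : v1 = 0) ?dot0r //.
  apply: row2P; rewrite mxE.
    by have /rowP/(_ 1) := r0; rewrite !mxE /= => /eqP; rewrite oppr_eq0 => /eqP.
  by have /rowP/(_ 0) := r0; rewrite !mxE.
have [v2 Cv2 v20] := full_dim_dot_neq0 _ _ C0 dC r0.
rewrite dot_quarter in v20.
pose W u := support K u + support K (- u).
have Wle u k k' : K k -> K k' -> `|dot u (k - k')| <= W u.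
  move=> Kk Kk'; rewrite ler_norml lerNl -dotNr opprB /W.
  by rewrite !width_ge.
exists ((W (quarter v2) + W (quarter v1)) / `|cross v2 v1|) => _ [u u0 <-].
rewrite ler_pdivrMr ?sym_support_gt0 // mulrAC ler_pdivlMr ?normr_gt0 //.
have [k Kk ->] := support_attained K u K0 cK.
have [k' Kk' ->] := support_attained K (- u) K0 cK.
rewrite dotNl -dotNr -dotDr -/(sym_support C u).
have : cross v2 v1 * dot u (k - k') =
   dot (quarter v1) (k - k') * dot u v2 - dot (quarter v2) (k - k') * dot u v1.
  by rewrite !dot_quarter !dot2E /cross; ring.
move/(congr1 Num.norm); rewrite normrM mulrC => e.
apply: (@le_trans _ _ (`|dot u (k - k')| * `|cross v2 v1|)).
  by rewrite ler_wpM2r // ler_norm.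
rewrite e (le_trans (ler_normB _ _)) // !normrM [leRHS]mulrDl addrC lerD //.
  by rewrite ler_pM // ?Wle // norm_dot_le_sym_support.
by rewrite ler_pM // ?Wle // norm_dot_le_sym_support.
Qed.

Lemma DMAX_diam K C : convex_body K -> convex_body C -> C 0 -> has_dim C 2 ->
  diam_le K C (DMAX K C).
Proof.
move=> bK bC C0 dC u p q Kp Kq; have [K0 cK _] := bK; have [_ cC _] := bC.
have [->|u0] := eqVneq u 0.
  by rewrite dot0l /sym_support oppr0 maxxx support0 ?mulr0 //; exists 0.
rewrite -ler_pdivrMr ?sym_support_gt0 //.
apply: le_trans (ub_le_sup (has_sup_DMAX _ _ bK bC C0 dC).2 _); last first.
  by exists u.
by rewrite ler_pM2r ?invr_gt0 ?sym_support_gt0 // width_ge.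
Qed.

Lemma DMAX_le K C D : convex_body K -> convex_body C -> C 0 -> has_dim C 2 ->
  diam_le K C D -> DMAX K C <= D.
Proof.
move=> bK bC C0 dC KD; have [K0 cK _] := bK; have [_ cC _] := bC.
apply: ge_sup; first exact: (has_sup_DMAX _ _ bK bC C0 dC).1.
move=> _ [u u0 <-]; rewrite ler_pdivrMr ?sym_support_gt0 //.
have [k Kk ->] := support_attained K u K0 cK.
have [k' Kk' ->] := support_attained K (- u) K0 cK.
by rewrite dotNl -dotNr -dotDr KD.
Qed.

Lemma DMAX_ge0 K C : convex_body K -> convex_body C -> C 0 -> has_dim C 2 ->
  0 <= DMAX K C.
Proof.
move=> bK bC C0 dC; have [[k Kk] cK _] := bK; have [_ cC _] := bC.
have e0 : (delta_mx 0 0 : 'rV[R]_2) != 0.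
  by apply/eqP => /rowP/(_ 0); rewrite !mxE !eqxx => /eqP; rewrite oner_eq0.
have := DMAX_diam _ _ bK bC C0 dC _ k k Kk Kk.
move=> /(_ (delta_mx 0 0)); rewrite subrr dot0r pmulr_lge0 //; exact: sym_support_gt0.
Qed.

End Bounds.

(** * The circumradius, duality and the equality case *)

Section Circumradius.
Context {R : realType}.
Implicit Types K C : set 'rV[R]_2.

(** A translate [t + rho *: C] contains [x] exactly when [t] lies in
    [x - rho *: C], so Helly's theorem reduces [K] to three of its points. *)
Lemma uncontained_triple K C (rho : R) :
  convex_body C -> 0 <= rho ->
  ~ (exists t, K `<=` [set t + rho *: x | x in C]) ->
  exists p1 p2 p3 a1 a2 a3, [/\ K p1, K p2, K p3, a1 + a2 + a3 = 0 &
    rho * (support C a1 + support C a2 + support C a3) <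
    dot a1 p1 + dot a2 p2 + dot a3 p3].
Proof.
move=> [C0 cC vC] rho0 far; apply: contrapT => H; apply: far.
pose G (x : 'rV[R]_2) : set 'rV[R]_2 := [set x + (- rho) *: c | c in C].
have GP x t : G x t <-> [set t + rho *: c | c in C] x.
  by split=> -[c Cc <-]; exists c => //; rewrite scaleNr ?subrK ?addrK.
have [|||t tG] := @helly_plane R 'rV[R]_2 K G.
- move=> x _; apply/convexP => _ _ k k0 k1 [c Cc <-] [c' Cc' <-].
  exists (k *: c + (1 - k) *: c'); first by move/convexP : vC; apply.
  by apply/rowP => i; rewrite !mxE; ring.
- move=> x _; apply: continuous_compact => //.
  exact/continuous_subspaceT/continuous_homothety.
- move=> p1 p2 p3 K1 K2 K3; apply: contrapT => H'; apply: H.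
  have [[t [t1 t2 t3]]|a1 [a2 [a3 [a0 lt]]]] :=
    translate_separation C rho p1 p2 p3 C0 cC vC rho0.
    by apply: H'; exists t; split; [split|]; apply/GP.
  by exists p1, p2, p3, a1, a2, a3.
- by exists t => x Kx; apply/GP/tG.
Qed.

(** A cluster point, as [s] tends to [r] from below, of points chosen in
    [W `&` Z s] lies in every [Z s]. *)
Lemma compact_nested_limit {T : topologicalType} (W : set T) (r : R) (Z : R -> set T) :
  compact W -> 0 < r ->
  (forall s, 0 <= s -> s < r -> closed (Z s)) ->
  (forall s s', 0 <= s -> s <= s' -> Z s' `<=` Z s) ->
  (forall s, 0 <= s -> s < r -> W `&` Z s !=set0) ->
  exists2 z, W z & forall s, 0 <= s -> s < r -> Z s z.
Proof.
move=> cW r0 clZ decZ WZ.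
have [f fP] : exists f : R -> T, forall s, 0 <= s -> s < r -> W (f s) /\ Z s (f s).
  have [z0 _] := WZ 0 (lexx 0) r0.
  have /choice[f fP] : forall s, exists z, 0 <= s -> s < r -> W z /\ Z s z.
    move=> s; have [[s0 sr]|H] := pselect (0 <= s /\ s < r).
      by have [z [Wz Zz]] := WZ s s0 sr; exists z.
    by exists z0 => s0 sr; exfalso; apply: H.
  by exists f.
have near_r s : s < r -> \forall x \near r^'-, s <= x /\ x < r.
  move=> sr; near=> x; split; last by near: x; exact: nbhs_left_lt.
  by apply: ltW; near: x; exact: nbhs_left_gt.
have [|z [Wz zc]] := cW (f @ r^'-) _.
  have := near_r 0 r0; apply: filterS => x [x0 xr].
  by have [] := fP x x0 xr.
exists z => // s s0 sr; apply: (clZ s s0 sr) => B Bz.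
have : (f @ r^'-) (Z s).
  have := near_r s sr; apply: filterS => x [sx xr].
  by have [_] := fP x (le_trans s0 sx) xr; exact: (decZ _ _ s0 sx).
by move=> /zc/(_ Bz).
Unshelve. all: by end_near.
Qed.

Lemma compact_box n : compact [set v : 'rV[R]_n | forall i, v ord0 i \in `[-1, 1]].
Proof.
apply: (@rV_compact _ _ (fun=> `[(-1 : R), 1]%classic)).
by move=> _; exact: segment_compact.
Qed.

Lemma coord_sqr_le n (v : 'rV[R]_n) i : v ord0 i ^+ 2 <= dot v v.
Proof.
rewrite dotE (bigD1 i) //= -expr2 lerDl sumr_ge0 // => j _.
by rewrite -expr2 sqr_ge0.
Qed.

Lemma compact_unit_pairs n : compact
  [set a : 'rV[R]_n * 'rV[R]_n | dot a.1 a.1 + dot a.2 a.2 = 1].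
Proof.
have cn : continuous (fun a : 'rV[R]_n * 'rV[R]_n => dot a.1 a.1 + dot a.2 a.2).
  have h1 := continuous_dot _ _ _ (@continuous_fst 'rV[R]_n 'rV[R]_n)
    (@continuous_fst 'rV[R]_n 'rV[R]_n).
  have h2 := continuous_dot _ _ _ (@continuous_snd 'rV[R]_n 'rV[R]_n)
    (@continuous_snd 'rV[R]_n 'rV[R]_n).
  by move=> a; exact: (cvgD (h1 a) (h2 a)).
apply: (subclosed_compact _ (compact_setX (compact_box n) (compact_box n))).
  apply: (@preimage_closed _ R (fun a : 'rV[R]_n * 'rV[R]_n =>
    dot a.1 a.1 + dot a.2 a.2) [set 1]).
    by move=> x _; exact: cn.
  exact: closed_eq.
have small (x : R) : x ^+ 2 <= 1 -> x \in `[-1, 1].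
  by rewrite in_itv /= -ler_norml -[x ^+ 2]ger0_norm ?sqr_ge0 // normrX expr_le1.
move=> [a b] /= ab1; split => i /=; apply: small.
  by apply: le_trans (coord_sqr_le _ a i) _; rewrite -ab1 lerDl dot_ge0.
by apply: le_trans (coord_sqr_le _ b i) _; rewrite -ab1 lerDr dot_ge0.
Qed.

(** The duality of [uncontained_triple] at the critical radius itself: normalised
    witnesses for [rho < r] range over a compact set, and the inequality is a
    closed condition that gets stronger as [rho] grows. *)
Lemma extremal_triple K C (r : R) :
  convex_body K -> convex_body C -> C 0 -> 0 < r ->
  (forall rho, 0 <= rho -> rho < r ->
    ~ (exists t, K `<=` [set t + rho *: x | x in C])) ->
  exists p1 p2 p3 a1 a2 a3, [/\ K p1, K p2 & K p3] /\
    [/\ a1 + a2 + a3 = 0, dot a1 a1 + dot a2 a2 = 1 &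
    r * (support C a1 + support C a2 + support C a3) <=
    dot a1 p1 + dot a2 p2 + dot a3 p3].
Proof.
move=> [K0 cK _] bC C0 r0 far; have [nC cC vC] := bC.
pose V := 'rV[R]_2.
pose T := ((V * V * V) * (V * V))%type.
pose W : set T := (K `*` K `*` K) `*` [set a | dot a.1 a.1 + dot a.2 a.2 = 1].
pose g (z : T) (s : R) (c : V * V * V) : R :=
  dot z.2.1 (z.1.1.1 + - s *: c.1.1) + dot z.2.2 (z.1.1.2 + - s *: c.1.2) +
  dot (- (z.2.1 + z.2.2)) (z.1.2 + - s *: c.2).
(* quantifying over points of C avoids the continuity of the support function *)
pose Z (s : R) : set T := \bigcap_(c in C `*` C `*` C) [set z | 0 <= g z s c].
pose P (z : T) : R :=
  dot z.2.1 z.1.1.1 + dot z.2.2 z.1.1.2 + dot (- (z.2.1 + z.2.2)) z.1.2.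
pose H (z : T) : R :=
  support C z.2.1 + support C z.2.2 + support C (- (z.2.1 + z.2.2)).
have gE z s c : g z s c = P z - s * (dot z.2.1 c.1.1 + dot z.2.2 c.1.2 +
    dot (- (z.2.1 + z.2.2)) c.2).
  by rewrite /g /P !dot_bilinear; ring.
have H0 z : 0 <= H z by rewrite /H !addr_ge0 ?support_ge0.
have ZP s z : 0 <= s -> Z s z <-> s * H z <= P z.
  move=> s0; split=> [Zz|sH [[c1 c2] c3] [[/= Cc1 Cc2] Cc3]].
    have [c1 Cc1 e1] := support_attained C z.2.1 nC cC.
    have [c2 Cc2 e2] := support_attained C z.2.2 nC cC.
    have [c3 Cc3 e3] := support_attained C (- (z.2.1 + z.2.2)) nC cC.
    have := Zz (c1, c2, c3) (conj (conj Cc1 Cc2) Cc3).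
    by rewrite /= gE subr_ge0 /H e1 e2 e3.
  rewrite /= gE subr_ge0 (le_trans _ sH) // ler_wpM2l //=.
  by rewrite !lerD ?dot_le_support.
have cg s c : continuous (fun z : T => g z s c).
  have d1 : continuous (fun z : T => z.1) :=
    @continuous_fst (V * V * V)%type (V * V)%type.
  have d2 : continuous (fun z : T => z.2) :=
    @continuous_snd (V * V * V)%type (V * V)%type.
  have d11 := continuousT_comp d1 (@continuous_fst (V * V)%type V).
  have d12 := continuousT_comp d1 (@continuous_snd (V * V)%type V).
  have d111 := continuousT_comp d11 (@continuous_fst V V).
  have d112 := continuousT_comp d11 (@continuous_snd V V).
  have d21 := continuousT_comp d2 (@continuous_fst V V).
  have d22 := continuousT_comp d2 (@continuous_snd V V).
  have tr (w : V) : continuous (fun x : V => (x + w : V)).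
    rewrite (_ : (fun _ => _) = fun x => w + 1 *: x);
      first exact: continuous_homothety.
    by apply/funext => x; rewrite scale1r addrC.
  have dN : continuous (fun z : T => - (z.2.1 + z.2.2) : V).
    by move=> z; exact: (cvgN (cvgD (d21 z) (d22 z))).
  have e1 := continuous_dot _ _ _ d21 (continuousT_comp d111 (tr (- s *: c.1.1))).
  have e2 := continuous_dot _ _ _ d22 (continuousT_comp d112 (tr (- s *: c.1.2))).
  have e3 := continuous_dot _ _ _ dN (continuousT_comp d12 (tr (- s *: c.2))).
  by move=> z; exact: (cvgD (cvgD (e1 z) (e2 z)) (e3 z)).
have [|||s s0 sr|[[[p1 p2] p3] [a1 a2]] [[[/= K1 K2] K3] a1a2] Zz] :=
    @compact_nested_limit T W r Z _ r0.
- apply: compact_setX; last exact: compact_unit_pairs.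
  by apply: compact_setX => //; exact: compact_setX.
- move=> s s0 sr; apply: closed_bigI => c _.
  apply: (@preimage_closed _ R (fun z : T => g z s c) [set x | 0 <= x]).
    by move=> z _; exact: cg.
  exact: closed_ge.
- move=> s s' s0 ss' z; rewrite !ZP //; last exact: le_trans ss'.
  by apply: le_trans; exact: ler_wpM2r.
- have [p1 [p2 [p3 [a1 [a2 [a3 [K1 K2 K3 a0 lt]]]]]]] :=
    uncontained_triple K C s bC s0 (far s s0 sr).
  have a3E : a3 = - (a1 + a2) by apply/eqP; rewrite -addr_eq0 addrC a0.
  rewrite a3E in lt.
  pose N := dot a1 a1 + dot a2 a2.
  have N0 : 0 < N.
    rewrite lt_neqAle eq_sym addr_ge0 ?dot_ge0 // andbT; apply/eqP => N0.
    have n1 := dot_ge0 a1; have n2 := dot_ge0 a2.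
    have z1 : a1 = 0 by apply: dot_eq0; move: N0; rewrite /N; lra.
    have z2 : a2 = 0 by apply: dot_eq0; move: N0; rewrite /N; lra.
    by move: lt; rewrite z1 z2 addr0 oppr0 !dot0l support0 // !addr0 mulr0 ltxx.
  pose k := (Num.sqrt N)^-1.
  have k0 : 0 <= k by rewrite invr_ge0 sqrtr_ge0.
  exists ((p1, p2, p3), (k *: a1, k *: a2)); split.
    split => //=; rewrite !dotZl !dotZr !mulrA -mulrDr -/N -expr2 exprVn.
    by rewrite sqr_sqrtr ?ltW // mulVf // gt_eqF.
  apply/ZP => //; rewrite /H /P /= -scalerDr -scalerN !supportZ // !dotZl.
  by rewrite -!mulrDr mulrCA ler_wpM2l // ltW.
exists p1, p2, p3, a1, a2, (- (a1 + a2)); split => //; split => //.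
  by rewrite subrr.
set z : T := (p1, p2, p3, (a1, a2)) in Zz.
have P0 : 0 <= P z by have := Zz 0 (lexx 0) r0; rewrite ZP // mul0r.
have : r * H z <= P z; last by [].
rewrite leNgt; apply/negP => PH.
have Hz : 0 < H z by rewrite -(pmulr_rgt0 _ r0); exact: le_lt_trans PH.
(* the inequality fails at every radius strictly between P z / H z and r *)
have := Zz ((P z / H z + r) / 2).
have q0 : 0 <= P z / H z by rewrite divr_ge0.
have qr : P z / H z < r by rewrite ltr_pdivrMr.
move=> /(_ ltac:(lra) ltac:(lra)); rewrite ZP; last lra.
rewrite -ler_pdivlMr //; lra.
Qed.

Lemma triple_le_sym K C D a1 a2 a3 p1 p2 p3 :
  compact C -> C 0 -> 0 <= D -> diam_le K C D -> K p1 -> K p2 -> K p3 ->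
  a1 + a2 + a3 = 0 ->
  dot a1 p1 + dot a2 p2 + dot a3 p3 <=
  3 / 2 * D * (support C a1 + support C a2 + support C a3).
Proof.
move=> cC C0 D0 KD K1 K2 K3 a0.
have a0' : a2 + a3 + a1 = 0 by rewrite addrC addrA.
have a0'' : a3 + a1 + a2 = 0 by rewrite addrC addrA addrC addrA.
have t1 := triple_le K C D _ _ _ _ _ _ cC C0 D0 KD K1 K2 K3 a0.
have t2 := triple_le K C D _ _ _ _ _ _ cC C0 D0 KD K2 K3 K1 a0'.
have t3 := triple_le K C D _ _ _ _ _ _ cC C0 D0 KD K3 K1 K2 a0''.
case: (leP (support C a2) (support C a1)) => h12;
case: (leP (support C a3) (support C a1)) => h13;
case: (leP (support C a3) (support C a2)) => h23.
all: first [exact: t1| have := t2 ltac:(lra) ltac:(lra); lra |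
  have := t3 ltac:(lra) ltac:(lra); lra | have := t1 ltac:(lra) ltac:(lra); lra].
Qed.

(** Stated as the existence of a translate rather than as a bound on the
    circumradius: the infimum of an empty set of radii would be [0]. *)
Lemma contained K C D : convex_body K -> convex_body C -> C 0 -> 0 <= D ->
  diam_le K C D -> exists t, K `<=` [set t + (3 / 2 * D) *: x | x in C].
Proof.
move=> bK bC C0 D0 KD; have [_ cC _] := bC; apply: contrapT => far.
have D32 : 0 <= 3 / 2 * D by rewrite mulr_ge0.
have [p1 [p2 [p3 [a1 [a2 [a3 [K1 K2 K3 a0]]]]]]] :=
    uncontained_triple K C _ bC D32 far.
by rewrite ltNge (triple_le_sym K).
Qed.

Lemma circumradius_le K C rho : 0 <= rho ->
  (exists t, K `<=` [set t + rho *: x | x in C]) -> circumradius K C <= rho.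
Proof. by move=> rho0 Kt; apply: ge_inf => //; exists 0 => x []. Qed.

Lemma DMAX_ge K C : convex_body K -> convex_body C -> C 0 -> has_dim C 2 ->
  2 / 3 * circumradius K C <= DMAX K C.
Proof.
move=> bK bC C0 dC; have D0 := DMAX_ge0 _ _ bK bC C0 dC.
have := contained _ _ _ bK bC C0 D0 (DMAX_diam _ _ bK bC C0 dC).
by move/circumradius_le => /(_ ltac:(lra)); lra.
Qed.

Lemma equality_triangle K C :
  convex_body K -> convex_body C -> C 0 -> has_dim C 2 ->
  ~ (exists x, K = [set x]) -> DMAX K C = 2 / 3 * circumradius K C ->
  exists p q, triangle 0 p q C.
Proof.
move=> bK bC C0 dC Kpt eqD.
have [[x Kx] cK _] := bK; have [nC cC _] := bC.
have KD := DMAX_diam _ _ bK bC C0 dC.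
set D := DMAX K C in eqD KD.
(* for D = 0 the diameter bound in the direction y - x gives y = x *)
have D0 : 0 < D.
  rewrite lt_neqAle DMAX_ge0 // andbT eq_sym; apply/eqP => D0; apply: Kpt; exists x.
  apply/seteqP; split=> [y Ky|_ -> //]; apply/subr0_eq/dot_eq0/eqP.
  by rewrite eq_le dot_ge0 andbT; have := KD (y - x) y x Ky Kx; rewrite D0 mul0r.
have [|rho rho0 rhoR Kt|p1 [p2 [p3 [a1 [a2 [a3 [[K1 K2 K3] [a0 a1a2 big]]]]]]]] :=
  extremal_triple K C (circumradius K C) bK bC C0; first by lra.
  by have := circumradius_le _ _ _ rho0 Kt; rewrite leNgt rhoR.
have {}big : 3 / 2 * D * (support C a1 + support C a2 + support C a3) <=
    dot a1 p1 + dot a2 p2 + dot a3 p3.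
  by rewrite (_ : 3 / 2 * D = circumradius K C) // eqD; field.
have h1 := support_ge0 C a1 cC C0; have h2 := support_ge0 C a2 cC C0.
have h3 := support_ge0 C a3 cC C0.
have S0 : 0 < support C a1 + support C a2 + support C a3.
  rewrite lt_neqAle eq_sym !addr_ge0 // andbT; apply/eqP => S0.
  have le0 y : C y -> [/\ dot a1 y <= 0, dot a2 y <= 0 & dot a3 y <= 0].
    move=> Cy; have := dot_le_support C a1 y nC cC Cy.
    have := dot_le_support C a2 y nC cC Cy; have := dot_le_support C a3 y nC cC Cy.
    by move=> *; split; lra.
  have eq0 y : C y -> dot a1 y = 0 /\ dot a2 y = 0.
    move=> /le0[]; have : dot (a1 + a2 + a3) y = 0 by rewrite a0 dot0l.
    by rewrite !dotDl; lra.
  have z1 : a1 = 0.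
    apply: contrapT => /eqP/(full_dim_dot_neq0 _ _ C0 dC)[y Cy].
    by have [-> _] := eq0 y Cy; rewrite eqxx.
  have z2 : a2 = 0.
    apply: contrapT => /eqP/(full_dim_dot_neq0 _ _ C0 dC)[y Cy].
    by have [_ ->] := eq0 y Cy; rewrite eqxx.
  by move: a1a2; rewrite z1 z2 dot0l addr0 => /esym/eqP; rewrite oner_eq0.
have a0' : a2 + a3 + a1 = 0 by rewrite addrC addrA.
have a0'' : a3 + a1 + a2 = 0 by rewrite addrC addrA addrC addrA.
have t1 := extremal_triangle K C D _ _ _ _ _ _ bC C0 D0 KD K1 K2 K3 a0.
have t2 := extremal_triangle K C D _ _ _ _ _ _ bC C0 D0 KD K2 K3 K1 a0'.
have t3 := extremal_triangle K C D _ _ _ _ _ _ bC C0 D0 KD K3 K1 K2 a0''.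
case: (leP (support C a2) (support C a1)) => h12;
case: (leP (support C a3) (support C a1)) => h13;
case: (leP (support C a3) (support C a2)) => h23.
all: first [by apply: t1; lra | by apply: t2; lra | by apply: t3; lra].
Qed.

End Circumradius.

(** * The converse: triangles with a vertex at the origin *)

Section Converse.
Context {R : realType}.
Implicit Types C : set 'rV[R]_2.

Lemma dual_basis (p q : 'rV[R]_2) : free [:: p; q] ->
  exists f g, [/\ dot f p = 1, dot f q = 0, dot g p = 0 & dot g q = 1].
Proof.
rewrite free_cons span_seq1 seq1_free => /andP[pq q0].
have c0 : cross p q != 0.
  apply: contraNneq pq => c0; apply/vlineP; exists (dot p q / dot q q).
  have qq : dot q q != 0 by apply: contraNneq q0 => /dot_eq0 ->.
  apply: (scalerI qq); rewrite scalerA mulrCA divff // mulr1.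
  apply/eqP; rewrite -subr_eq0; apply/eqP; rewrite !dot2E; apply: row2P; rewrite !mxE.
    transitivity (q 0 1 * cross p q); last by rewrite c0 mulr0.
    by rewrite /cross; ring.
  transitivity (- q 0 0 * cross p q); last by rewrite c0 mulr0.
  by rewrite /cross; ring.
exists ((cross p q)^-1 *: quarter q), (- (cross p q)^-1 *: quarter p).
have cE : cross q p = - cross p q by rewrite /cross; ring.
have cc (x : 'rV[R]_2) : cross x x = 0 by rewrite /cross; ring.
rewrite !dotZl !dot_quarter !cc !mulr0 mulVf // cE mulrNN mulVf //.
Qed.

(** The extremal [K] is the image of [C] under the affine map sending [0], [p],
    [q] to [3/4 (p + q)], [q/2], [p/2], which makes its compactness and convexity
    immediate. In the coordinates [f], [g] dual to [p], [q], differences of points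
    of [K] have coordinates with absolute values summing to at most 1, whereas a
    triangle [t + rho *: C] containing the three vertices needs [f t <= 0],
    [g t <= 0] and [3/2 <= (f + g) t + rho]. *)
Lemma triangle_equality C : convex_body C -> C 0 -> has_dim C 2 ->
  (exists p q, triangle 0 p q C) ->
  exists K, [/\ convex_body K, ~ (exists x, K = [set x]) &
    DMAX K C = 2 / 3 * circumradius K C].
Proof.
move=> bC C0 dC [p [q [/=]]]; rewrite !subr0 => /dual_basis[f [g [fp fq gp gq]]] CE.
have [nC cC vC] := bC.
have {}CE x : C x <-> exists s t : R,
    [/\ 0 <= s, 0 <= t, s + t <= 1 & x = s *: p + t *: q].
  by rewrite CE convex_hull_triangle.
have Cp : C p.
  by apply/CE; exists 1, 0; rewrite scale0r scale1r !addr0 lexx ler01.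
have Cq : C q.
  by apply/CE; exists 0, 1; rewrite scale0r scale1r !add0r lexx ler01.
pose phi (x : 'rV[R]_2) : 'rV[R]_2 :=
  (3 / 4) *: (p + q) + (- (1 / 2)) *: x + (- (1 / 4) * dot (f + g) x) *: (p + q).
have phi0 : phi 0 = (3 / 4) *: (p + q).
  by rewrite /phi dot0r scaler0 mulr0 scale0r !addr0.
have phip : phi p = (1 / 2) *: q.
  by rewrite /phi dotDl fp gp; apply/rowP => i; rewrite !mxE; field.
have phiq : phi q = (1 / 2) *: p.
  by rewrite /phi dotDl fq gq; apply/rowP => i; rewrite !mxE; field.
pose K := [set phi x | x in C].
have bK : convex_body K.
  split; first by exists (phi 0), 0.
    apply: continuous_compact => //; apply/continuous_subspaceT => x.
    have c1 := continuous_homothety R 2 ((3 / 4) *: (p + q)) (- (1 / 2)) x.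
    have c2 : (fun y : 'rV[R]_2 => (- (1 / 4) * dot (f + g) y : R)) y @[y --> x] -->
        (- (1 / 4) * dot (f + g) x).
      have c3 := @cst_continuous 'rV[R]_2 R (- (1 / 4)) x.
      exact: (cvgM c3 (continuous_dotr (f + g) x)).
    have c4 : (fun y : 'rV[R]_2 => ((- (1 / 4) * dot (f + g) y : R) *: (p + q) : 'rV[R]_2)) y
        @[y --> x] --> (- (1 / 4) * dot (f + g) x) *: (p + q).
      exact: (@cvgZl _ _ _ _ _ _ _ (p + q) c2).
    exact: (cvgD c1 c4).
  apply/convexP => _ _ k k0 k1 [x Cx <-] [y Cy <-].
  exists (k *: x + (1 - k) *: y); first by move/convexP : vC; apply.
  by rewrite /phi; apply/rowP => i; rewrite !dotDr !dotZr !mxE; field.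
have Kd : diam_le K C 1.
  move=> u _ _ [_ /CE[s [t [s0 t0 st ->]]] <-] [_ /CE[s' [t' [s'0 t'0 st' ->]]] <-].
  have up := norm_dot_le_sym_support C u p cC Cp.
  have uq := norm_dot_le_sym_support C u q cC Cq.
  rewrite (_ : phi _ - phi _ = ((3 * (s' - s) + (t' - t)) / 4) *: p +
     (((s' - s) + 3 * (t' - t)) / 4) *: q).
    rewrite dotDr !dotZr mul1r.
    set a := (_ / 4); set b := (_ / 4).
    have G0 : 0 <= sym_support C u by exact: le_trans up.
    have ab : `|a| + `|b| <= 1.
      by rewrite /a /b; case: (ler0P (_ / 4)) => ?; case: (ler0P (_ / 4)) => ?; lra.
    have := ler_wpM2r G0 ab; rewrite mul1r; apply: le_trans.
    apply: le_trans (ler_norm _) _; rewrite (le_trans (ler_normD _ _)) //.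
    by rewrite !normrM [leRHS]mulrDl lerD // ler_wpM2l.
  by rewrite /phi !dot_bilinear fp fq gp gq; apply/rowP => i; rewrite !mxE; field.
have R32 : 3 / 2 <= circumradius K C.
  apply: lb_le_inf.
    by have [t Kt] :=
      contained _ _ _ bK bC C0 ler01 Kd; exists (3 / 2 * 1); split; [lra|exists t].
  move=> rho [rho0 [t Kt]].
  have pos x : C x -> [/\ 0 <= dot f x, 0 <= dot g x & dot f x + dot g x <= 1].
    move=> /CE[s [t' [s0 t0 st ->]]].
    by rewrite !dotDr !dotZr fp fq gp gq !mulr0 !mulr1 addr0 add0r.
  have [c1 /pos[fc1 gc1 fgc1] e1] := Kt _ (ex_intro2 _ _ 0 C0 phi0).
  have [c2 /pos[fc2 gc2 fgc2] e2] := Kt _ (ex_intro2 _ _ p Cp phip).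
  have [c3 /pos[fc3 gc3 fgc3] e3] := Kt _ (ex_intro2 _ _ q Cq phiq).
  move/(congr1 (dot (f + g))) : e1; move/(congr1 (dot f)) : e2;
    move/(congr1 (dot g)) : e3.
  rewrite !dotDl !dotDr !dotZr !dotDr fp fq gp gq => e3 e2 e1.
  have := mulr_ge0 rho0 fc2; have := mulr_ge0 rho0 gc3; have := ler_wpM2l rho0 fgc1.
  lra.
exists K; split => //.
  move=> [x Kx].
  have Kphi y : C y -> phi y = x.
    by move=> Cy; rewrite -[_ = _]/([set x] (phi y)) -Kx; exists y.
  have := congr1 (dot f) (Kphi _ C0); rewrite -(Kphi _ Cp) phi0 phip.
  by rewrite !dotZr dotDr fp fq; lra.
apply/eqP; rewrite eq_le DMAX_ge // andbT.
by have := DMAX_le _ _ _ bK bC C0 dC Kd; lra.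
Qed.

End Converse.

Theorem theorem4p7 (R : realType) :
  (forall K C : set 'rV[R]_2,
     convex_body K -> convex_body C -> C 0 -> has_dim C 2 ->
     2 / 3 * circumradius K C <= DMAX K C)
  /\
  (forall C : set 'rV[R]_2,
     convex_body C -> C 0 -> has_dim C 2 ->
     ((exists K : set 'rV[R]_2,
         [/\ convex_body K, ~ (exists x, K = [set x])
           & DMAX K C = 2 / 3 * circumradius K C])
      <-> exists p q : 'rV[R]_2, triangle 0 p q C)).
Proof.
split=> [K C|C bC C0 dC]; first exact: DMAX_ge.
split=> [[K [bK Kpt eqD]]|]; last exact: triangle_equality.
exact: equality_triangle bK bC C0 dC Kpt eqD.
Qed.
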